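(* Let $M\in\mathbb{R}^{d\times d}$ be Hurwitz and $C\in\mathbb{R}^{d\times n}$ with $(M,C)$ controllable, and write $M=(J-A)\Sigma^{-1}$ with $\Sigma,A,J$ as defined in the context. Let $b\in\mathbb{R}^k$ and let $K\in\mathbb{R}^{d\times d}$ be such that $-K_{11}\in\mathbb{R}^{k\times k}$ is Hurwitz, and such that, with $\alpha=-K_{21}K_{11}^{-1}$, $\hat M=\alpha M_{12}+M_{22}$ and $\hat C=(\alpha C_{11}+C_{21}\ \ \alpha C_{12}+C_{22})$, the matrix $\hat M$ is Hurwitz and $(\hat M,\hat C)$ is controllable. Let $\hat\mu^{\varepsilon=0}=\mathcal{N}(\hat m,\hat\Sigma)$ and $\mu_c=\mathcal{N}(m_c,\Sigma_c)$ be the Gaussian measures on $\mathbb{R}^{d-k}$ defined in the context. Below, $*$ denotes arbitrary blocks. Then the following hold. (i) If $K=\begin{pmatrix}K_{11}&*\\(A-J)_{21}(A-J)_{11}^{-1}K_{11}&*\end{pmatrix}$ with $(A-J)_{11}$ invertible, then $\hat\mu^{\varepsilon=0}=\mu_c$. (ii) If $K=\begin{pmatrix}K_{11}&*\\\Sigma_{21}\Sigma_{11}^{-1}K_{11}&*\end{pmatrix}$, then $\hat\Sigma=\Sigma_c$. In general, $\hat m\neq m_c$ for $b\ne0$ (that is, there are data $M$, $C$, $K$, $b$ with $K=\begin{pmatrix}K_{11}&*\\\Sigma_{21}\Sigma_{11}^{-1}K_{11}&*\end{pmatrix}$ and $b\neq0$, such that $M$ is Hurwitz, $(M,C)$ is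 controllable, $-K_{11}$ is Hurwitz, $\hat M$ is Hurwitz and $(\hat M,\hat C)$ is controllable, for which $\hat m\ne m_c$). (iii) If $\Sigma_{12}=0$ and $K=\begin{pmatrix}K_{11}&*\\(A_{21}-J_{21})(A_{11}+\bar J)^{-1}K_{11}&*\end{pmatrix}$, where $\bar J\in\mathbb{R}^{k\times k}$ is any skew-symmetric matrix such that $A_{11}+\bar J$ is invertible, then $\hat\Sigma=\Sigma_c$.
   Context: Here $1\le k<d$. A matrix $S\in\mathbb{R}^{d\times d}$ is partitioned as $S=\begin{pmatrix}S_{11}&S_{12}\\S_{21}&S_{22}\end{pmatrix}$ with $S_{11}\in\mathbb{R}^{k\times k}$, $S_{22}\in\mathbb{R}^{(d-k)\times(d-k)}$. For $C\in\mathbb{R}^{d\times n}$ the rows are split in the same way and the columns into two consecutive groups, so that $\hat C\in\mathbb{R}^{(d-k)\times n}$ is the matrix of the last $d-k$ rows of $PC$, where $P=\begin{pmatrix}0&0\\\alpha&I\end{pmatrix}$. The notation $(A-J)_{11}^{-1}$ means the inverse of the block $(A-J)_{11}$. A matrix is Hurwitz if all its eigenvalues have strictly negative real part. A pair $(M,C)$ with $M\in\mathbb{R}^{r\times r}$ and $C$ having $r$ rows is controllable if $\mathrm{rank}[C,MC,\ldots,M^{r-1}C]=r$. Standing definitions: $\Sigma\in\mathbb{R}^{d\times d}$ is the unique symmetric positive definite solution of $M\Sigma+\Sigma M^T=-2CC^T$; $A:=CC^T$ is symmetric positive semidefinite; $J:=\frac12(M\Sigma-\Sigma M^T)$ is skew-symmetric;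 then $M=(J-A)\Sigma^{-1}$. The conditional measure $\mu_c=\mathcal{N}(m_c,\Sigma_c)$, with $m_c=\Sigma_{21}\Sigma_{11}^{-1}b$ and $\Sigma_c=\Sigma_{22}-\Sigma_{21}\Sigma_{11}^{-1}\Sigma_{12}$, is the law of $x^2$ given $x^1=b$ under $\mathcal{N}(0,\Sigma)$. The measure $\hat\mu^{\varepsilon=0}=\mathcal{N}(\hat m,\hat\Sigma)$ has mean $\hat m=-\hat M^{-1}(\alpha M_{11}+M_{21})b$ and covariance $\hat\Sigma$, the unique positive definite solution of $\hat M\hat\Sigma+\hat\Sigma\hat M^T=-2\hat C\hat C^T$. It is the invariant measure of the component $Y^2$ of $dY_t=PMY_t\,dt+\sqrt2\,PC\,dW_t$ with $Y^1_t\equiv Y^1_0=b$. *)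

(* Defs.v *)
From HB Require Import structures.
From mathcomp Require Import all_boot all_order all_algebra.
From mathcomp Require Import complex.
From mathcomp Require Import all_classical all_reals all_analysis.
From mathcomp Require Import measurable_realfun.

Set Implicit Arguments.
Unset Strict Implicit.
Unset Printing Implicit Defensive.

Import Order.TTheory GRing.Theory Num.Theory.
Import numFieldNormedType.Exports.

Local Open Scope classical_set_scope.
Local Open Scope ring_scope.

Section stability.
Context {R : realType}.

Definition hurwitz r (M : 'M[R]_r) : Prop :=
  forall z : R[i], eigenvalue (map_mx (real_complex R) M) z -> complex.Re z < 0.

Definition controllable r n (M : 'M[R]_r) (C : 'M[R]_(r, n)) : Prop :=
  \rank (\mxrow_(i < r) (M ^+ i *m C)) = r.

Definition posdef r (S : 'M[R]_r) : Prop :=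
  S^T = S /\ forall x : 'cV[R]_r, x != 0 -> 0 < (x^T *m S *m x) 0 0.

(* When M is Hurwitz and (M, C) is controllable, there is exactly one such S. *)
Definition stationary_cov r n (M : 'M[R]_r) (C : 'M[R]_(r, n)) (S : 'M[R]_r)
    : Prop :=
  posdef S /\ M *m S + S *m M^T = - 2 *: (C *m C^T).

End stability.

Section lebesgue_tuple.
Context {R : realType}.
Local Notation T := (measurableTypeR R).
Local Open Scope ereal_scope.

Definition cons_pair n (p : T * n.-tuple T) : n.+1.-tuple T :=
  [the n.+1.-tuple T of p.1 :: p.2].

Lemma measurable_cons_pair n : measurable_fun setT (@cons_pair n).
Proof. exact: measurable_cons. Qed.

Section step.
Context n (mu : {sigma_finite_measure set (n.-tuple T) -> \bar R}).

Definition lebesgue_cons := pushforward (lebesgue_measure \x mu) (@cons_pair n).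

Let lebesgue_cons_measure : {measure set (n.+1.-tuple T) -> \bar R} :=
  measure_function_pushforward__canonical__measure_function_Measure
    (lebesgue_measure \x mu) (@measurable_cons_pair n).

HB.instance Definition _ := Measure.copy lebesgue_cons lebesgue_cons_measure.

Let lebesgue_cons_sigma_finite : sigma_finite setT lebesgue_cons.
Proof.
have /sigma_finiteP[F [TF ndF Foo]] :=
  sigma_finiteT (@lebesgue_measure R : {sigma_finite_measure set T -> \bar R}).
have /sigma_finiteP[G [TG ndG Goo]] := sigma_finiteT mu.
pose g (t : n.+1.-tuple T) : T * n.-tuple T := (thead t, [tuple of behead t]).
have mg : measurable_fun setT g.
  by apply: measurable_fun_pair; [exact: measurable_tnth|exact: measurable_behead].
exists (fun i => g @^-1` (F i `*` G i)).
  rewrite -preimage_bigcup -[LHS](preimage_setT g); congr (g @^-1` _).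
  rewrite -setXTT TF TG predeqE => -[x y]; split.
    move=> [/= [i _ Fix] [k _ Gky]]; exists (maxn i k) => //; split.
    - by move: x Fix; exact/subsetPset/ndF/leq_maxl.
    - by move: y Gky; exact/subsetPset/ndG/leq_maxr.
  by move=> [i _ []/= ? ?]; split; exists i.
move=> i; have [mF Fi] := Foo i; have [mG Gi] := Goo i.
have mFG : measurable (F i `*` G i) by exact: measurableX.
split; first by rewrite -[X in measurable X]setTI; exact: mg.
rewrite /lebesgue_cons /pushforward -comp_preimage.
rewrite (_ : g \o @cons_pair n = id); last first.
  by apply/funext => -[x t]; congr pair; apply/val_inj.
rewrite preimage_id product_measure1E// lte_mul_pinfty// ge0_fin_numE//.
Qed.

HB.instance Definition _ :=
  Measure_isSigmaFinite.Build _ _ _ lebesgue_cons lebesgue_cons_sigma_finite.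

End step.

Fixpoint lebesgue_tuple n : {sigma_finite_measure set (n.-tuple T) -> \bar R} :=
  if n is n'.+1 then lebesgue_cons (lebesgue_tuple n')
  else dirac ([tuple] : 0.-tuple T).

End lebesgue_tuple.

Section gaussian.
Context {R : realType} (n : nat).
Local Notation T := (measurableTypeR R).
Implicit Types (m : 'cV[R]_n) (S : 'M[R]_n).

Definition gaussian_pdf m S (x : n.-tuple T) : R :=
  let y := \col_(i < n) tnth x i - m in
  (Num.sqrt ((2 * pi) ^+ n * \det S))^-1
    * expR (- (y^T *m invmx S *m y) 0 0 / 2).

Lemma gaussian_pdf_ge0 m S x : 0 <= gaussian_pdf m S x.
Proof. by rewrite mulr_ge0// ?invr_ge0// expR_ge0. Qed.

Lemma measurable_gaussian_pdf m S : measurable_fun setT (gaussian_pdf m S).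
Proof.
have mc (i : 'I_n) : measurable_fun setT
    (fun x : n.-tuple T => (\col_(i < n) tnth x i - m) i 0).
  rewrite (_ : (fun _ => _) = fun x : n.-tuple T => tnth x i - m i 0).
    by apply: measurable_funB => //; exact: measurable_tnth.
  by apply/funext => x; rewrite !mxE.
apply: measurable_funM => //; apply: measurableT_comp => //.
apply: measurable_funM => //; apply: measurableT_comp => //.
rewrite (_ : (fun _ => _) = fun x : n.-tuple T =>
    \sum_j (\sum_i (\col_(i < n) tnth x i - m) i 0 * invmx S i j)
      * (\col_(i < n) tnth x i - m) j 0).
  apply: measurable_sum => j; apply: measurable_funM => //.
  by apply: measurable_sum => i; apply: measurable_funM.
apply/funext => x; rewrite mxE; apply: eq_bigr => j _; congr (_ * _).
by rewrite mxE; apply: eq_bigr => i _; rewrite [X in X * _]mxE.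
Qed.

(* For S positive definite, the normal law N(m, S); a column vector is
   represented by the tuple of its entries. *)
Definition gaussian m S : set (n.-tuple T) -> \bar R :=
  fun A => (\int[lebesgue_tuple n]_(x in A) (gaussian_pdf m S x)%:E)%E.

Section measure.
Context m S.

Let gaussian0 : gaussian m S set0 = 0%E.
Proof. by rewrite /gaussian integral_set0. Qed.

Let gaussian_ge0 A : (0 <= gaussian m S A)%E.
Proof. by apply: integral_ge0 => x _; rewrite lee_fin gaussian_pdf_ge0. Qed.

Let gaussian_sigma_additive : semi_sigma_additive (gaussian m S).
Proof.
move=> A mA tA mUA; rewrite /gaussian ge0_integral_bigcup//=.
- apply: is_cvg_ereal_nneg_natsum_cond => i _ _.
  by apply: integral_ge0 => x _; rewrite lee_fin gaussian_pdf_ge0.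
- apply: (measurable_funS measurableT) => //.
  by apply/measurable_EFinP; exact: measurable_gaussian_pdf.
- by move=> x _; rewrite lee_fin gaussian_pdf_ge0.
Qed.

HB.instance Definition _ := isMeasure.Build _ _ _
  (gaussian m S) gaussian0 gaussian_ge0 gaussian_sigma_additive.

End measure.
End gaussian.

Section blocks.
Context {R : realType} {k m n1 n2 : nat}.
Implicit Types (M K Sigma : 'M[R]_(k + m)) (C : 'M[R]_(k + m, n1 + n2))
  (b : 'cV[R]_k).

Definition symA C : 'M[R]_(k + m) := C *m C^T.

Definition skewJ M Sigma : 'M[R]_(k + m) :=
  2^-1 *: (M *m Sigma - Sigma *m M^T).

Definition alpha K : 'M[R]_(m, k) := - (dlsubmx K *m invmx (ulsubmx K)).

Definition hatM K M : 'M[R]_m := alpha K *m ursubmx M + drsubmx M.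

Definition hatC K C : 'M[R]_(m, n1 + n2) :=
  row_mx (alpha K *m ulsubmx C + dlsubmx C) (alpha K *m ursubmx C + drsubmx C).

Definition hat_mean K M b : 'cV[R]_m :=
  - (invmx (hatM K M) *m (alpha K *m ulsubmx M + dlsubmx M) *m b).

Definition cond_mean Sigma b : 'cV[R]_m :=
  dlsubmx Sigma *m invmx (ulsubmx Sigma) *m b.

Definition cond_cov Sigma : 'M[R]_m :=
  drsubmx Sigma - dlsubmx Sigma *m invmx (ulsubmx Sigma) *m ursubmx Sigma.

Record admissible M C K Sigma hatSigma : Prop := Admissible {
  hurwitz_M : hurwitz M;
  controllable_MC : controllable M C;
  hurwitz_NK11 : hurwitz (- ulsubmx K);
  hurwitz_hatM : hurwitz (hatM K M);
  controllable_hat : controllable (hatM K M) (hatC K C);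
  cov_Sigma : stationary_cov M C Sigma;
  cov_hatSigma : stationary_cov (hatM K M) (hatC K C) hatSigma
}.

End blocks.

(* Main.v *)
Require Import Defs.
From mathcomp Require Import all_boot all_order all_algebra.
From mathcomp Require Import complex ring lra zify.
From mathcomp Require Import all_classical all_reals all_analysis.

(** Write [N = M Sigma], which is [J - A], and let [Pi = (alpha I)] be the block
of nonzero rows of [P].  Then [Pi M = (a hatM)] with [a = alpha M11 + M21],
[hatC hatC^T = Pi A Pi^T], and [N + N^T = - 2 A].  Since [hatM] is Hurwitz, the
Lyapunov equation for [hatSigma] has a single solution
([lyapunov_unique]), so each covariance claim amounts to checking that the
symmetric part of [hatM Sigma_c] is [- Pi A Pi^T].

In (i) and (ii) this holds because [hatM Sigma_c = Pi N Pi^T].  The choice of [K]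
in (i) makes the first block of [Pi N] vanish, i.e. [Pi M Sigma = (0 X)].
The first block of this equation gives [a = - hatM Sigma21 Sigma11^-1],
which is the equality of the means, and substituting it in the second gives
[X = hatM Sigma_c].  The choice in (ii) makes the first block of
[Pi Sigma] vanish, i.e. [Pi Sigma = (0 Sigma_c)], and one multiplies its
transpose by [Pi M].  In (iii), [Sigma] is block diagonal, so
[hatM Sigma_c = alpha N12 + N22], which falls short of [Pi N Pi^T] by
[(alpha N11 + N21) alpha^T].  The choice of [K] means
[N21 = alpha (A11 + barJ)], so this defect is [alpha (J11 + barJ) alpha^T], a
skew matrix that the symmetric part does not see.

For the means to differ in (ii) it suffices to have [Sigma = I]: then
[alpha = 0], [m_c = 0] and [hat m = - M22^-1 M21 b].  So [M = J - C C^T] must be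
controllable together with its block [M22], and [M21] must be nonzero.  A chain of
[k + m] sites with nearest-neighbour skew coupling, damped and forced at its last
site only ([schwarz] and [end_input]), works in all dimensions and with a
single noise: its last [m] sites form a shorter chain of the same kind.
Controllability follows from the staircase shape of the Krylov vectors
([hessenberg_controllable]), and stability from dissipation plus
controllability ([hurwitz_of_dissipation]). *)

Set Implicit Arguments.
Unset Strict Implicit.
Unset Printing Implicit Defensive.

Import Order.TTheory GRing.Theory Num.Theory.

Local Open Scope ring_scope.

(** * Uniqueness for Sylvester and Lyapunov equations *)

Lemma eigenvalue_unitmx (F : fieldType) n (A : 'M[F]_n) z :
  eigenvalue A z = (A - z%:M \notin unitmx).
Proof. by rewrite /eigenvalue /eigenspace kermx_eq0 row_free_unit. Qed.

(** The relation [A X = X B] turns the factor [A - z] next to [X] into an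
invertible factor on its right, which can be cancelled, leaving the same relation
for the rest. *)
Lemma prod_XsubC_annihilates (F : fieldType) n p (A : 'M[F]_n) (B : 'M[F]_p)
    (s : seq F) (X : 'M[F]_(n, p)) :
  (forall z, z \in s -> ~~ eigenvalue B z) -> A *m X = X *m B ->
  (\prod_(z <- s) (A - z%:M)) *m X = 0 -> X = 0.
Proof.
elim/last_ind: s X => [|s z IH] X nB AX.
  by rewrite big_nil mul1mx.
rewrite -cats1 big_cat big_seq1 /= -[_ * _]/(_ *m _) -mulmxA.
have -> : (A - z%:M) *m X = X *m (B - z%:M).
  by rewrite mulmxBl mulmxBr AX mul_scalar_mx mul_mx_scalar.
move=> sX0.
have Bz : B - z%:M \in unitmx.
  by have := nB z; rewrite mem_rcons mem_head eigenvalue_unitmx negbK; exact.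
suff XB0 : X *m (B - z%:M) = 0 by rewrite -[X](mulmxK Bz) XB0 mul0mx.
apply: IH => // [y ys|]; first by apply: nB; rewrite mem_rcons inE ys orbT.
by rewrite mulmxA AX -!mulmxA mulmxBl mulmxBr mul_scalar_mx mul_mx_scalar.
Qed.

(** By Cayley-Hamilton, the product of the [A - z] over the roots [z] of the
characteristic polynomial of [A] vanishes, and no such [z] is an eigenvalue of
[B]. *)
Lemma sylvester_homogeneous (F : closedFieldType) n p (A : 'M[F]_n)
    (B : 'M[F]_p) (X : 'M[F]_(n, p)) :
  (forall z, eigenvalue A z -> ~~ eigenvalue B z) -> A *m X = X *m B -> X = 0.
Proof.
case: n A X => [|n] A X AB AX; first by rewrite [X]flatmx0.
have [s sE] := closed_field_poly_normal (char_poly A).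
move: sE; rewrite (monicP (char_poly_monic A)) scale1r => sE.
apply: (@prod_XsubC_annihilates _ _ _ A B s) => // [z zs|].
  by apply: AB; rewrite eigenvalue_root_char sE root_prod_XsubC.
have <- : horner_mx A (char_poly A) = \prod_(z <- s) (A - z%:M).
  rewrite sE rmorph_prod; apply: eq_bigr => z _.
  by rewrite rmorphB /= horner_mx_X horner_mx_C.
by rewrite Cayley_Hamilton mul0mx.
Qed.

(** * Hurwitz and controllable pairs *)

Section hurwitz.
Context {R : realType}.
Local Notation cplx := (map_mx (real_complex R)).

Lemma hurwitz_unitmx r (M : 'M[R]_r) : hurwitz M -> M \in unitmx.
Proof.
move=> HM; rewrite -(map_unitmx (real_complex R)).
have [//|nu] := boolP (cplx M \in unitmx).
have := HM 0; rewrite eigenvalue_unitmx (raddf0 (@scalar_mx _ _)) subr0 ltxx.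
by move/(_ nu).
Qed.

(** The difference of two solutions intertwines [- M^T] and [M], whose spectra lie
in opposite open half planes. *)
Lemma lyapunov_unique r (M S T Q : 'M[R]_r) : hurwitz M ->
  M *m S + S *m M^T = Q -> M *m T + T *m M^T = Q -> S = T.
Proof.
move=> HM MS MT; apply/eqP; rewrite -subr_eq0 -(map_mx_eq0 (real_complex R)).
apply/eqP; apply: (@sylvester_homogeneous _ _ _ (cplx M) (- (cplx M)^T)).
  move=> z Mz; apply/negP => Mtz.
  have /HM : eigenvalue (cplx M) (- z).
    have -> : eigenvalue (cplx M) (- z) = eigenvalue (- (cplx M)^T) z.
      rewrite !eigenvalue_unitmx -unitmx_tr -(unitmxZ _ (unitrN1 _)).
      by rewrite scaleN1r linearB /= tr_scalar_mx raddfN /= opprB addrC.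
    exact: Mtz.
  by have := HM _ Mz; case: z {Mz Mtz} => a b /= a0; rewrite oppr_lt0 ltNge ltW.
rewrite mulmxN map_trmx -!map_mxM -map_mxN; congr map_mx.
apply/eqP; rewrite -addr_eq0 mulmxBr mulmxBl addrACA -opprD MS MT.
by rewrite subrr.
Qed.

Lemma posdef_ulsubmx_unitmx k m (S : 'M[R]_(k + m)) :
  posdef S -> ulsubmx S \in unitmx.
Proof.
move=> [_ S_gt0]; rewrite -unitmx_tr -row_free_unit; apply: inj_row_free => v vS.
apply/eqP/negPn/negP => v0; have := S_gt0 (col_mx v^T 0).
rewrite -[S]submxK tr_col_mx mul_row_block trmxK trmx0 !mul0mx !addr0.
rewrite mul_row_col mulmx0 addr0 -mulmxA -[_ *m v^T]trmxK trmx_mul trmxK vS.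
rewrite trmx0 mulmx0 mxE ltxx; suff -> : col_mx v^T (0 : 'cV[R]_m) != 0 by move/(_ isT).
by rewrite col_mx_eq0 trmx_eq0 (negPf v0).
Qed.

(** One direction of the Hautus test: if [C] kills a left eigenvector of [M], then so
does every [M ^+ i *m C]. *)
Lemma controllable_left_eigenvector r n (M : 'M[R]_r) (C : 'M[R]_(r, n)) z
    (v : 'rV[R[i]]_r) :
  controllable M C -> v *m cplx M = z *: v -> v *m cplx C = 0 -> v = 0.
Proof.
move=> ctr vM vC; apply: (row_free_inj (A := cplx (\mxrow_(i < r) (M ^+ i *m C)))).
  by rewrite /row_free mxrank_map ctr.
have vMC i : v *m cplx (M ^+ i *m C) = 0.
  have vMi : v *m cplx (M ^+ i) = z ^+ i *: v.
    elim: i => [|i IH]; first by rewrite expr0 scale1r map_mx1 mulmx1.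
    rewrite exprSr map_mxM mulmxA IH -scalemxAl vM scalerA exprSr //.
  by rewrite map_mxM mulmxA vMi -scalemxAl vC scaler0.
have -> : cplx (\mxrow_(i < r) (M ^+ i *m C))
    = \mxrow_(i < r) cplx (M ^+ i *m C).
  by apply/matrixP => i j; rewrite !mxE.
rewrite mul0mx mul_mxrow -[RHS](mxrow0 (q_ := fun=> n)).
by apply: eq_mxrow => i; rewrite vMC.
Qed.

(** For a left eigenvector [v] with eigenvalue [z], sandwiching the
hypothesis between [v] and its adjoint gives [Re z |v|^2 = - |v C|^2]; equality
[Re z = 0] would mean [v C = 0], which controllability forbids. *)
Lemma hurwitz_of_dissipation r n (M : 'M[R]_r) (C : 'M[R]_(r, n)) :
  M + M^T = - 2 *: (C *m C^T) -> controllable M C -> hurwitz M.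
Proof.
move=> MMT ctr z /eigenvalueP[v vM v0].
pose adj p q (A : 'M[R[i]]_(p, q)) := map_mx (@conjc R) A^T.
pose sq p (w : 'rV[R[i]]_p) : R :=
  \sum_j (complex.Re (w 0 j) ^+ 2 + complex.Im (w 0 j) ^+ 2).
have sqE p (w : 'rV[R[i]]_p) : w *m adj _ _ w = (sq _ w)%:C%C%:M.
  apply/matrixP => i j; rewrite (ord1 i) (ord1 j) !mxE eqxx mulr1n /sq.
  rewrite (raddf_sum (real_complex R)); apply: eq_bigr => l _; rewrite !mxE.
  case: (w 0 l) => a b /=; apply/eqP; rewrite eq_complex /=.
  by apply/andP; split; apply/eqP; ring.
have sq_ge0 p (w : 'rV[R[i]]_p) : 0 <= sq _ w.
  by apply: sumr_ge0 => j _; rewrite addr_ge0 ?sqr_ge0.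
have sq_eq0 p (w : 'rV[R[i]]_p) : sq _ w = 0 -> w = 0.
  move/eqP; rewrite psumr_eq0 => [/allP w0|j _]; last first.
    by rewrite addr_ge0 ?sqr_ge0.
  apply/rowP => j; have := w0 j (mem_index_enum j).
  rewrite paddr_eq0 ?sqr_ge0 // !sqrf_eq0 mxE.
  by case: (w 0 j) => a b /= /andP[/eqP-> /eqP->].
have adjM p q s (A : 'M[R[i]]_(p, q)) (B : 'M[R[i]]_(q, s)) :
    adj _ _ (A *m B) = adj _ _ B *m adj _ _ A.
  by rewrite /adj trmx_mul map_mxM.
have adj_cplx p q (A : 'M[R]_(p, q)) : adj _ _ (cplx A) = cplx A^T.
  by apply/matrixP => i j; rewrite !mxE /= oppr0.
have key : complex.Re z * sq _ v = - sq _ (v *m cplx C).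
  have vMv : v *m cplx M *m adj _ _ v = (z * (sq _ v)%:C%C)%:M.
    by rewrite vM -scalemxAl sqE scale_scalar_mx.
  (* The adjoint of the eigenvector equation. *)
  have vMTv : v *m cplx M^T *m adj _ _ v = (conjc z * (sq _ v)%:C%C)%:M.
    have := congr1 (adj _ _) vM; rewrite adjM adj_cplx => vMT.
    rewrite -mulmxA vMT.
    have -> : adj _ _ (z *: v) = conjc z *: adj _ _ v.
      by apply/matrixP => i j; rewrite !mxE rmorphM.
    by rewrite -scalemxAr sqE scale_scalar_mx.
  have vCv : v *m cplx (C *m C^T) *m adj _ _ v = (sq _ (v *m cplx C))%:C%C%:M.
    by rewrite -sqE adjM adj_cplx map_mxM !mulmxA.
  have : v *m cplx (M + M^T) *m adj _ _ v = (- 2 * (sq _ (v *m cplx C))%:C%C)%:M.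
    rewrite MMT map_mxZ -scalemxAr -scalemxAl vCv scale_scalar_mx.
    by rewrite rmorphN rmorph_nat.
  rewrite map_mxD mulmxDr mulmxDl vMv vMTv -raddfD /=.
  move=> /matrixP/(_ 0 0); rewrite !mxE !eqxx !mulr1n.
  case: z {vM vMv vMTv} => a b /(congr1 (@complex.Re R)) /=.
  move=> E; apply: (mulfI (_ : 2 != 0 :> R)); first by rewrite pnatr_eq0.
  by move: E; rewrite !(mulr0, addr0, subr0, mul0r, oppr0) => E; lra.
rewrite ltNge; apply/negP => z_ge0.
have vC0 : v *m cplx C = 0.
  apply: sq_eq0; apply/eqP; rewrite eq_le sq_ge0 andbT -oppr_ge0 -key.
  by rewrite mulr_ge0.
by move: v0; rewrite (controllable_left_eigenvector ctr vM vC0) eqxx.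
Qed.

Lemma posdef1 r : posdef (1%:M : 'M[R]_r).
Proof.
split=> [|x x0]; first by rewrite tr_scalar_mx.
rewrite mulmx1 mxE lt0r; apply/andP; split; last first.
  by apply: sumr_ge0 => i _; rewrite mxE -expr2 sqr_ge0.
apply: contra_neq x0 => /eqP; rewrite psumr_eq0 => [/allP x0|i _]; last first.
  by rewrite mxE -expr2 sqr_ge0.
apply/matrixP => i j; rewrite (ord1 j) mxE; apply/eqP.
by have := x0 i (mem_index_enum i); rewrite mxE -expr2 sqrf_eq0.
Qed.

End hurwitz.

(** * Projection of the covariance and of the mean *)

Section projection.
Context {R : realType} {k m n1 n2 : nat}.
Implicit Types (M K Sigma : 'M[R]_(k + m)) (C : 'M[R]_(k + m, n1 + n2)).

Local Notation Pi K := (row_mx (alpha K) (1%:M : 'M[R]_m)).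

Lemma row_alphaM p1 p2 K (B : 'M[R]_(k + m, p1 + p2)) :
  Pi K *m B = row_mx (alpha K *m ulsubmx B + dlsubmx B)
                    (alpha K *m ursubmx B + drsubmx B).
Proof. by rewrite -{1}[B]submxK mul_row_block !mul1mx. Qed.

Lemma tr_cond_cov Sigma : Sigma^T = Sigma -> (cond_cov Sigma)^T = cond_cov Sigma.
Proof.
move=> ST; rewrite /cond_cov linearB /= !trmx_mul trmx_drsub trmx_inv.
by rewrite trmx_ulsub trmx_dlsub trmx_ursub ST mulmxA.
Qed.

Lemma stationary_cov_flux M C Sigma :
  stationary_cov M C Sigma -> M *m Sigma + (M *m Sigma)^T = - (symA C *+ 2).
Proof. by move=> [[ST _]]; rewrite trmx_mul ST scaleNr scaler_nat. Qed.

Lemma skewJ_sub_symA M C Sigma :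
  stationary_cov M C Sigma -> skewJ M Sigma - symA C = M *m Sigma.
Proof.
move=> cov; have [[ST _] _] := cov.
apply/matrixP => i j; have /matrixP/(_ i j) := stationary_cov_flux cov.
rewrite /skewJ -[in Sigma *m M^T]ST -trmx_mul.
move: (symA C) (M *m Sigma) => A N; rewrite !mxE; lra.
Qed.

Lemma alpha_of_dlsubmx M C K Sigma hatSigma (G : 'M[R]_(m, k)) :
  admissible M C K Sigma hatSigma ->
  dlsubmx K = G *m ulsubmx K -> alpha K = - G.
Proof.
move=> adm KG; have := hurwitz_unitmx (hurwitz_NK11 adm).
rewrite -scaleN1r unitmxZ ?unitrN1 // => K11.
by rewrite /alpha KG mulmxK.
Qed.

(** Since [hatC = Pi C], the right-hand side is that of the Lyapunov equation of
[hatSigma]. *)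
Lemma hatSigma_eq_cond_cov M C K Sigma hatSigma :
  admissible M C K Sigma hatSigma ->
  hatM K M *m cond_cov Sigma + (hatM K M *m cond_cov Sigma)^T
    = - ((Pi K *m symA C *m (Pi K)^T) *+ 2) ->
  hatSigma = cond_cov Sigma.
Proof.
move=> adm hE; have [_ hatE] := cov_hatSigma adm.
apply: (lyapunov_unique (hurwitz_hatM adm) hatE).
have [[ST _] _] := cov_Sigma adm.
rewrite -{2}(tr_cond_cov ST) -trmx_mul hE scaleNr scaler_nat; congr (- (_ *+ _)).
by rewrite /symA -mulmxA -[_ *m (Pi K)^T]mulmxA -trmx_mul mulmxA row_alphaM.
Qed.

(** The symmetric part of [M *m Sigma] is [- symA C], hence that of
[Pi M Sigma Pi^T] is [- Pi A Pi^T]. *)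
Lemma hatSigma_eq_cond_cov_of_flux M C K Sigma hatSigma :
  admissible M C K Sigma hatSigma ->
  hatM K M *m cond_cov Sigma = Pi K *m (M *m Sigma) *m (Pi K)^T ->
  hatSigma = cond_cov Sigma.
Proof.
move=> adm hE; apply: (hatSigma_eq_cond_cov adm); rewrite hE.
have := stationary_cov_flux (cov_Sigma adm).
move: (M *m Sigma) => N flux; rewrite !trmx_mul trmxK mulmxA -mulmxDl -mulmxDr.
by rewrite flux mulmxN mulNmx mulr2n mulmxDr mulmxDl.
Qed.

(** The hypothesis says that the first block of [Pi M Sigma] vanishes; solving for
[alpha M11 + M21] gives the mean, and eliminating it gives
[Pi M Sigma = (0 (hatM Sigma_c))]. *)
Lemma oblique_projection_exact M C K Sigma hatSigma :
  admissible M C K Sigma hatSigma ->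
  alpha K *m ulsubmx (M *m Sigma) + dlsubmx (M *m Sigma) = 0 ->
  hatSigma = cond_cov Sigma /\
  forall b, hat_mean K M b = cond_mean Sigma b.
Proof.
move=> adm N0.
have S11 := posdef_ulsubmx_unitmx (cov_Sigma adm).1.
pose a := alpha K *m ulsubmx M + dlsubmx M.
have LN : Pi K *m (M *m Sigma)
    = row_mx 0 (alpha K *m ursubmx (M *m Sigma) + drsubmx (M *m Sigma)).
  by rewrite row_alphaM N0.
have := LN; rewrite mulmxA row_alphaM -[X in _ *m X]submxK mul_row_block.
move=> /eq_row_mx[aS1 aS2].
have aE : a = - (hatM K M *m (dlsubmx Sigma *m invmx (ulsubmx Sigma))).
  apply/eqP; rewrite -addr_eq0 -[a](mulmxK S11) mulmxA -mulmxDl.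
  by rewrite aS1 mul0mx.
split=> [|b].
  apply: (hatSigma_eq_cond_cov_of_flux adm).
  rewrite LN tr_row_mx mul_row_col mul0mx add0r trmx1 mulmx1 -aS2.
  by rewrite -/(hatM K M) -/a aE mulNmx mulmxBr !mulmxA addrC.
rewrite /hat_mean -/a aE mulmxN mulKmx ?mulNmx ?opprK //.
exact: hurwitz_unitmx (hurwitz_hatM adm).
Qed.

(** Here [Pi] is the elimination step of the Schur complement:
[Pi Sigma = (0 Sigma_c)].  The first block of [Pi M] is multiplied by zero, hence
is not seen by the covariance, although it enters the mean. *)
Lemma orthogonal_projection_cov M C K Sigma hatSigma :
  admissible M C K Sigma hatSigma ->
  alpha K = - (dlsubmx Sigma *m invmx (ulsubmx Sigma)) ->
  hatSigma = cond_cov Sigma.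
Proof.
move=> adm aE; have [Spd _] := cov_Sigma adm; have [ST _] := Spd.
have S11 := posdef_ulsubmx_unitmx Spd.
have LS : Pi K *m Sigma = row_mx 0 (cond_cov Sigma).
  rewrite row_alphaM aE !mulNmx mulmxKV // addNr; congr row_mx.
  by rewrite /cond_cov addrC.
apply: (hatSigma_eq_cond_cov_of_flux adm).
rewrite mulmxA -mulmxA -{2}ST -trmx_mul LS row_alphaM tr_row_mx mul_row_col.
by rewrite trmx0 mulmx0 add0r tr_cond_cov.
Qed.

(** With [N = J - A] and [G = A21 - J21], the symmetric parts of [Pi N Pi^T] and
of [alpha N12 + N22], which is [hatM Sigma_c] here, agree as soon as
[G alpha^T + alpha G^T = - 2 alpha A11 alpha^T]; for
[G = - alpha (A11 + barJ)] this holds because [alpha barJ alpha^T] is skew. *)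
Lemma block_diag_cov M C K Sigma hatSigma (barJ : 'M[R]_k) :
  admissible M C K Sigma hatSigma ->
  ursubmx Sigma = 0 -> barJ^T = - barJ ->
  dlsubmx (symA C) - dlsubmx (skewJ M Sigma)
    = - alpha K *m (ulsubmx (symA C) + barJ) ->
  hatSigma = cond_cov Sigma.
Proof.
move=> adm S12 bJ GE; apply: (hatSigma_eq_cond_cov adm).
have [[ST _] _] := cov_Sigma adm.
have S21 : dlsubmx Sigma = 0 by rewrite -ST -trmx_ursub S12 trmx0.
have MS := skewJ_sub_symA (cov_Sigma adm).
have -> : hatM K M *m cond_cov Sigma
   = alpha K *m ursubmx (M *m Sigma) + drsubmx (M *m Sigma).
  have := row_alphaM K (M *m Sigma); rewrite mulmxA row_alphaM.
  rewrite -[X in _ *m X]submxK mul_row_block S12 S21 !mulmx0 add0r.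
  move=> /eq_row_mx[_ <-].
  by rewrite /cond_cov S12 mulmx0 subr0.
have AT : (symA C)^T = symA C by rewrite trmx_mul trmxK.
have JT : (skewJ M Sigma)^T = - skewJ M Sigma.
  by rewrite /skewJ linearZ linearB /= !trmx_mul trmxK ST -scalerN opprB.
move: GE AT JT; rewrite -MS; move: (symA C) (skewJ M Sigma) (alpha K) => A J P.
rewrite mulNmx mulmxDr => GE AT JT.
have A12 : (ursubmx A)^T = dlsubmx A by rewrite trmx_ursub AT.
have J12 : (ursubmx J)^T = - dlsubmx J.
  by rewrite trmx_ursub JT; apply/matrixP => i j; rewrite !mxE.
have A22 : (drsubmx A)^T = drsubmx A by rewrite trmx_drsub AT.
have J22 : (drsubmx J)^T = - drsubmx J.
  by rewrite trmx_drsub JT; apply/matrixP => i j; rewrite !mxE.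
have A11 : (ulsubmx A)^T = ulsubmx A by rewrite trmx_ulsub AT.
have GPt : dlsubmx A *m P^T - dlsubmx J *m P^T
    = - (P *m ulsubmx A *m P^T + P *m barJ *m P^T).
  by rewrite -mulmxBl GE mulNmx mulmxDl.
have PGt : P *m ursubmx A + P *m ursubmx J
    = - (P *m ulsubmx A *m P^T - P *m barJ *m P^T).
  apply: (can_inj (@trmxK _ _ _)).
  rewrite linearD linearN linearB /= !trmx_mul trmxK A12 J12 A11 bJ.
  by rewrite mulNmx GPt mulNmx mulmxN opprK !mulmxA.
have -> : row_mx P 1%:M *m A *m (row_mx P (1%:M : 'M[R]_m))^T
    = P *m ulsubmx A *m P^T + dlsubmx A *m P^T + (P *m ursubmx A + drsubmx A).
  rewrite -[X in _ *m X *m _]submxK mul_row_block !mul1mx tr_row_mx trmx1.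
  by rewrite mul_row_col mulmx1 mulmxDl.
have -> : ursubmx (J - A) = ursubmx J - ursubmx A.
  by apply/matrixP => i j; rewrite !mxE.
have -> : drsubmx (J - A) = drsubmx J - drsubmx A.
  by apply/matrixP => i j; rewrite !mxE.
rewrite mulmxBr linearD !linearB /= !trmx_mul.
move: GPt PGt A22 J22; rewrite A12 J12 mulNmx.
move: (P *m ulsubmx A *m P^T) (P *m barJ *m P^T) (dlsubmx A *m P^T)
  (dlsubmx J *m P^T) (P *m ursubmx A) (P *m ursubmx J) (drsubmx A) (drsubmx J).
(* What is left is linear in these blocks, entry by entry. *)
move=> Z W Y2 Y1 X2 X1 A22 J22 /matrixP h1 /matrixP h2 /matrixP h3 /matrixP h4.
apply/matrixP => i j; move: (h1 i j) (h2 i j) (h3 i j) (h4 i j).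
by rewrite !mxE; lra.
Qed.

End projection.

(** * A chain for which the means differ *)

Section chain.
Context {R : realType}.

(** Each application of [M] moves the first nonzero entry up by exactly one
row, starting from the last one. *)
Lemma krylov_hessenberg r (M : 'M[R]_r) (u : 'cV[R]_r) :
  (forall i j : 'I_r, (i.+1 < j)%N -> M i j = 0) ->
  (forall i j : 'I_r, i.+1 = j -> M i j != 0) ->
  (forall i : 'I_r, (u i 0 != 0) = (i.+1 == r)) ->
  forall (t : nat) (i : 'I_r),
    ((i + t.+1 < r)%N -> (M ^+ t *m u) i 0 = 0) /\
    ((i + t.+1)%N = r -> (M ^+ t *m u) i 0 != 0).
Proof.
move=> M0 M1 uE; elim=> [|t IH] i.
  rewrite expr0 mul1mx addn1 uE; split=> [ir|->]; last by rewrite eqxx.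
  by apply/eqP/negPn; rewrite uE ltn_eqF.
rewrite exprS -[M * _]/(M *m _) -mulmxA mxE; split=> itr.
  apply: big1 => j _; have [ij|ji] := ltnP i.+1 j; first by rewrite M0 ?mul0r.
  by rewrite (IH j).1 ?mulr0 //; lia.
have i1r : (i.+1 < r)%N by lia.
rewrite (bigD1 (Ordinal i1r)) //= big1 => [|j /eqP/val_eqP/= ji].
  by rewrite addr0 mulf_neq0 ?M1 ?(IH _).2 //=; lia.
have [ij|ij] := ltnP i.+1 j; first by rewrite M0 ?mul0r.
by rewrite (IH j).1 ?mulr0 //; lia.
Qed.

(** The Krylov vectors of the column [c] form a triangular system with nonzero
diagonal, which determines the entries of [v] from the last to the first. *)
Lemma hessenberg_controllable r n (M : 'M[R]_r) (C : 'M[R]_(r, n)) (c : 'I_n) :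
  (forall i j : 'I_r, (i.+1 < j)%N -> M i j = 0) ->
  (forall i j : 'I_r, i.+1 = j -> M i j != 0) ->
  (forall i : 'I_r, (C i c != 0) = (i.+1 == r)) ->
  controllable M C.
Proof.
move=> M0 M1 Cc; apply/eqP; rewrite -/(row_free _); apply: inj_row_free => v.
rewrite mul_mxrow -[X in _ = X](mxrow0 (q_ := fun=> n)) => /eq_mxrowP vMC.
have kry := @krylov_hessenberg r M (col c C) M0 M1.
have {}kry := kry (fun i => etrans (congr1 (fun x => x != 0) (mxE _ _ i 0)) (Cc i)).
have vu (t : 'I_r) : \sum_i v 0 i * (M ^+ t *m col c C) i 0 = 0.
  transitivity ((v *m (M ^+ t *m C)) 0 c); last by rewrite vMC mxE.
  rewrite mxE; apply: eq_bigr => i _; congr (_ * _); rewrite !mxE.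
  by apply: eq_bigr => j _; rewrite mxE.
have v0 t : forall i : 'I_r, (i + t.+1)%N = r -> v 0 i = 0.
  elim/ltn_ind: t => t IH i itr; have tr : (t < r)%N by lia.
  have := vu (Ordinal tr); rewrite (bigD1 i) //= big1 => [/eqP|j ji].
    by rewrite addr0 mulf_eq0 (negPf ((kry t i).2 itr)) orbF => /eqP.
  have [jr|rj] := ltnP (j + t.+1) r; first by rewrite (kry t j).1 ?mulr0.
  have jr := ltn_ord j; have jin : (j : nat) != i by [].
  by rewrite (IH (r - j.+1)%N) ?mul0r //; move/eqP: jin; lia.
apply/rowP => i; rewrite mxE (v0 (r - i.+1)%N) //.
by have := ltn_ord i; lia.
Qed.

(** The Schwarz form with all couplings equal to 1 and the dissipation in its
last entry. *)
Definition schwarz r : 'M[R]_r :=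
  \matrix_(i, j) ((i.+1 == j)%:R - (j.+1 == i)%:R
                  - ((i == j) && (i.+1 == r))%:R).

Definition end_input r n : 'M[R]_(r, n) :=
  \matrix_(i, j) ((i.+1 == r) && (j == 0%N :> nat))%:R.

Lemma schwarz_dissipation r n : (0 < n)%N ->
  schwarz r + (schwarz r)^T = - 2 *: (end_input r n *m (end_input r n)^T).
Proof.
case: n => // n _; apply/matrixP => i j; rewrite !mxE (bigD1 0) //= big1 => [|l l0].
  rewrite !mxE !eqxx !andbT addr0 eq_sym -natrM mulnb.
  have -> : (i.+1 == r) && (j.+1 == r) = (i == j) && (i.+1 == r).
    apply/andP/andP => [[/eqP ir /eqP jr]|[/eqP-> ->]//]; split; last by apply/eqP.
    by apply/eqP/val_inj/eq_add_S; rewrite ir jr.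
  have -> : (j == i) && (j.+1 == r) = (i == j) && (i.+1 == r).
    by rewrite eq_sym; case: eqP => // ->.
  by rewrite eq_sym; ring.
by rewrite !mxE (negbTE (l0 : (l : nat) != 0%N)) !andbF mul0r.
Qed.

Lemma schwarz_controllable r n : (0 < n)%N ->
  controllable (schwarz r) (end_input r n).
Proof.
case: n => // n _; apply: (hessenberg_controllable (c := 0)) => [i j ij|i j ij|i].
- have [ij1 ij2 ij3] : [/\ (i.+1 == j) = false, (j.+1 == i) = false
      & (i == j) = false].
    by split; rewrite -?val_eqE /=; lia.
  by rewrite mxE ij1 ij2 ij3 !subr0.
- have [ij1 ij2 ij3] : [/\ (i.+1 == j), (j.+1 == i) = false
      & (i == j) = false].
    by split; rewrite -?val_eqE /=; lia.
  by rewrite mxE ij1 ij2 ij3 !subr0 oner_eq0.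
- by rewrite mxE andbT pnatr_eq0 eqb0 negbK.
Qed.

Lemma schwarz_hurwitz r : hurwitz (schwarz r).
Proof.
exact: (hurwitz_of_dissipation (@schwarz_dissipation r 1 isT) (schwarz_controllable _ _)).
Qed.

Lemma schwarz_stationary_cov r n : (0 < n)%N ->
  stationary_cov (schwarz r) (end_input r n) 1%:M.
Proof.
move=> n0; split; first exact: posdef1.
by rewrite mulmx1 mul1mx (schwarz_dissipation _ n0).
Qed.

(** Cutting off the first [k] sites leaves a chain of the same kind, so both the full
and the reduced pair of the example are covered by the same lemmas. *)
Lemma drsubmx_schwarz k m : drsubmx (schwarz (k + m)) = schwarz m.
Proof.
apply/matrixP => i j; rewrite !mxE /= -!addnS !eqn_add2l.
by rewrite (inj_eq (@rshift_inj _ _)).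
Qed.

Lemma dlsubmx_schwarz k m (i : 'I_m) (j : 'I_k) :
  dlsubmx (schwarz (k + m)) i j = - ((j.+1 == k) && (i == 0%N :> nat))%:R.
Proof.
rewrite !mxE -val_eqE /=; have jk := ltn_ord j.
have -> : ((k + i).+1 == j) = false by lia.
have -> : (k + i == j)%N = false by lia.
have -> : (j.+1 == k + i)%N = (j.+1 == k) && (i == 0%N :> nat) by lia.
by rewrite sub0r subr0.
Qed.

(** With [Sigma = 1] the conditional mean is zero, while the coupling between the
last site of the first block and the first site of the second one moves
[hat_mean] as soon as [b] charges the former. *)
Lemma orthogonal_projection_mean_differs k m n1 n2 :
  (0 < k)%N -> (0 < m)%N -> (0 < n1 + n2)%N ->
  exists (M K Sigma : 'M[R]_(k + m)) (C : 'M[R]_(k + m, n1 + n2))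
      (b : 'cV[R]_k) (hatSigma : 'M[R]_m),
    [/\ admissible M C K Sigma hatSigma,
        dlsubmx K = dlsubmx Sigma *m invmx (ulsubmx Sigma) *m ulsubmx K,
        b != 0 & hat_mean K M b <> cond_mean Sigma b].
Proof.
move=> k0 m0 n0; pose M : 'M[R]_(k + m) := schwarz (k + m).
pose C : 'M[R]_(k + m, n1 + n2) := end_input (k + m) (n1 + n2).
pose b : 'cV[R]_k := \col_j (j.+1 == k)%:R.
have one_blocks : (1%:M : 'M[R]_(k + m)) = block_mx 1%:M 0 0 1%:M.
  by rewrite -scalar_mx_block.
have ul1 : ulsubmx (1%:M : 'M[R]_(k + m)) = 1%:M by rewrite one_blocks block_mxKul.
have dl1 : dlsubmx (1%:M : 'M[R]_(k + m)) = 0 by rewrite one_blocks block_mxKdl.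
have alpha0 : alpha (1%:M : 'M[R]_(k + m)) = 0 by rewrite /alpha dl1 mul0mx oppr0.
have hatME : hatM 1%:M M = schwarz m.
  by rewrite /hatM alpha0 mul0mx add0r drsubmx_schwarz.
have hatCE : hatC 1%:M C = end_input m (n1 + n2).
  rewrite /hatC alpha0 !mul0mx !add0r -[RHS]hsubmxK.
  by congr row_mx; apply/matrixP => i j; rewrite !mxE /= -addnS eqn_add2l.
exists M, 1%:M, 1%:M, C, b, 1%:M; split.
- split; rewrite ?hatME ?hatCE.
  + exact: schwarz_hurwitz.
  + exact: schwarz_controllable.
  + rewrite ul1 => z /eigenvalueP[v vz v0].
    have : (z + 1) *: v = 0.
      by rewrite scalerDl scale1r -vz map_mxN map_mx1 mulmxN mulmx1 addNr.
    move/eqP; rewrite scaler_eq0 (negPf v0) orbF addr_eq0 => /eqP ->.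
    by rewrite /= oppr_lt0 ltr01.
  + exact: schwarz_hurwitz.
  + exact: schwarz_controllable.
  + exact: schwarz_stationary_cov.
  + exact: schwarz_stationary_cov.
- by rewrite dl1 !mul0mx.
- have k1 : (k.-1 < k)%N by rewrite prednK.
  apply/eqP => /matrixP/(_ (Ordinal k1) 0); rewrite !mxE /= prednK // eqxx.
  by move/eqP; rewrite oner_eq0.
- rewrite /cond_mean dl1 !mul0mx /hat_mean hatME alpha0 mul0mx add0r.
  move=> /eqP; rewrite oppr_eq0 -mulmxA => /eqP/(canRL (mulKVmx _)).
  move=> /(_ (hurwitz_unitmx (@schwarz_hurwitz m))).
  rewrite mulmx0 => /matrixP/(_ (Ordinal m0) 0).
  have k1 : (k.-1 < k)%N by rewrite prednK.
  rewrite mxE (bigD1 (Ordinal k1)) //= big1 => [|j /eqP/val_eqP/= jk].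
    rewrite dlsubmx_schwarz !mxE /= prednK // !eqxx mulN1r addr0.
    by move/eqP; rewrite oppr_eq0 oner_eq0.
  rewrite dlsubmx_schwarz (_ : (j.+1 == k) = false) /= ?oppr0 ?mul0r //.
  by lia.
Qed.

End chain.

(** * The invariant measure of the projected dynamics *)

Theorem proposition4p6 (R : realType) (k m n1 n2 : nat)
    (k_gt0 : (0 < k)%N) (m_gt0 : (0 < m)%N) :
  [/\ (* (i) *)
      forall (M K Sigma : 'M[R]_(k + m)) (C : 'M[R]_(k + m, n1 + n2))
          (b : 'cV[R]_k) (hatSigma : 'M[R]_m),
        admissible M C K Sigma hatSigma ->
        let A := symA C in let J := skewJ M Sigma in
        ulsubmx (A - J) \in unitmx ->
        dlsubmx K = dlsubmx (A - J) *m invmx (ulsubmx (A - J)) *m ulsubmx K ->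
        forall B : set (m.-tuple (measurableTypeR R)), measurable B ->
          gaussian (hat_mean K M b) hatSigma B
            = gaussian (cond_mean Sigma b) (cond_cov Sigma) B,
      (* (ii) *)
      (forall (M K Sigma : 'M[R]_(k + m)) (C : 'M[R]_(k + m, n1 + n2))
          (hatSigma : 'M[R]_m),
        admissible M C K Sigma hatSigma ->
        dlsubmx K = dlsubmx Sigma *m invmx (ulsubmx Sigma) *m ulsubmx K ->
        hatSigma = cond_cov Sigma)
      /\ ((0 < n1 + n2)%N ->
        exists (M K Sigma : 'M[R]_(k + m)) (C : 'M[R]_(k + m, n1 + n2))
          (b : 'cV[R]_k) (hatSigma : 'M[R]_m),
        [/\ admissible M C K Sigma hatSigma,
            dlsubmx K = dlsubmx Sigma *m invmx (ulsubmx Sigma) *m ulsubmx K,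
            b != 0 & hat_mean K M b <> cond_mean Sigma b]) &
      (* (iii) *)
      forall (M K Sigma : 'M[R]_(k + m)) (C : 'M[R]_(k + m, n1 + n2))
          (hatSigma : 'M[R]_m) (barJ : 'M[R]_k),
        admissible M C K Sigma hatSigma ->
        let A := symA C in let J := skewJ M Sigma in
        ursubmx Sigma = 0 ->
        barJ^T = - barJ ->
        ulsubmx A + barJ \in unitmx ->
        dlsubmx K
          = (dlsubmx A - dlsubmx J) *m invmx (ulsubmx A + barJ) *m ulsubmx K ->
        hatSigma = cond_cov Sigma].
Proof.
split; [|split|].
- move=> M K Sigma C b hatSigma adm A J N11 KG B _.
  have NE := skewJ_sub_symA (cov_Sigma adm).
  have aE := alpha_of_dlsubmx adm KG.
  have [|-> ->//] := oblique_projection_exact adm.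
  rewrite -NE -opprB -/A -/J aE; set D := A - J in N11 *.
  have -> : ulsubmx (- D) = - ulsubmx D by apply/matrixP => i j; rewrite !mxE.
  have -> : dlsubmx (- D) = - dlsubmx D by apply/matrixP => i j; rewrite !mxE.
  by rewrite mulNmx mulmxN opprK mulmxKV // subrr.
- move=> M K Sigma C hatSigma adm KG.
  exact: (orthogonal_projection_cov adm (alpha_of_dlsubmx adm KG)).
- exact: orthogonal_projection_mean_differs.
- move=> M K Sigma C hatSigma barJ adm A J S12 bJ unit11 KG.
  apply: (block_diag_cov adm S12 bJ).
  by rewrite (alpha_of_dlsubmx adm KG) opprK mulmxKV.
Qed.
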